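(* Fix arbitrary constants $C_1>c_2>0$ and $K>0$, and suppose $C_1M\log_2 M\ge n\ge c_2 M\log_2 M$ (with $M\to\infty$). Then there exist $m\in\mathbb{N}$, $c>0$ and $0<\eta<\beta<1$ such that the following holds: there is a constant $c'>0$ such that for all sufficiently large $M$ and any $\mathcal{I}\subset[0,\pi/2]$ with $|\mathcal{I}|\le 2^{cn}$, \[\mathbb{P}\bigl[\mathcal{S}(K,m,\beta,\eta,\mathcal{I})\ne\varnothing\bigr]\le 2^{-c'n}.\]
   Context: Let $\Sigma_n=\{-1,1\}^n$. Fix $K>0$, $m\in\mathbb{N}$, $0<\eta<\beta<1$ and $\mathcal{I}\subset[0,\pi/2]$. Let $\mathcal{M}_0,\mathcal{M}_1,\dots,\mathcal{M}_m\in\mathbb{R}^{M\times n}$ be i.i.d. random matrices, each with i.i.d. standard normal entries, and for $\tau\in[0,\pi/2]$ set $\mathcal{M}_i(\tau)=\cos(\tau)\mathcal{M}_0+\sin(\tau)\mathcal{M}_i$. Let $\mathcal{S}(K,m,\beta,\eta,\mathcal{I})$ be the set of $m$-tuples $(\boldsymbol{\sigma}_1,\dots,\boldsymbol{\sigma}_m)\in\Sigma_n^m$ such that (i) $\beta-\eta\le n^{-1}\langle\boldsymbol{\sigma}_i,\boldsymbol{\sigma}_j\rangle\le\beta$ for all $1\le i<j\le m$, and (ii) there exist $\tau_1,\dots,\tau_m\in\mathcal{I}$ with $\max_{1\le i\le m}\|\mathcal{M}_i(\tau_i)\boldsymbol{\sigma}_i\|_\infty\le K$. *)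

(* Defs.v *)
From mathcomp Require Import all_boot all_order all_algebra.
From mathcomp Require Import all_classical all_reals all_analysis.

Set Implicit Arguments.
Unset Strict Implicit.
Unset Printing Implicit Defensive.

Import Order.TTheory GRing.Theory Num.Theory.
Import numFieldNormedType.Exports.

Local Open Scope classical_set_scope.
Local Open Scope ring_scope.

Definition log2 {R : realType} (x : R) : R := ln x / ln 2.

Section random_variables.
Context {d : measure_display} {T : measurableType d} {R : realType}.
Variable P : probability T R.

Definition mutually_independent (I : finType) (X : I -> {RV P >-> R}) : Prop :=
  forall (J : {set I}) (B : I -> set R),
    (forall i, i \in J -> measurable (B i)) ->
    P (\bigcap_(i in [set` J]) (X i @^-1` B i)) =
      (\prod_(i in J) P (X i @^-1` B i))%E.

(* The second parameter of [normal_prob] is the standard deviation. *)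
Definition standard_normal (X : {RV P >-> R}) : Prop :=
  forall B : set R, measurable B -> distribution P X B = normal_prob 0 1 B.

(* Requiring the k random matrices to be i.i.d. and each of them to have
   i.i.d. N(0,1) entries amounts to the k * M * n entries being jointly
   independent and N(0,1). *)
Definition iid_gaussian_matrices (k M n : nat)
    (G : 'I_k * 'I_M * 'I_n -> {RV P >-> R}) : Prop :=
  mutually_independent G /\ forall e, standard_normal (G e).

Definition matrices_at (k M n : nat) (G : 'I_k * 'I_M * 'I_n -> {RV P >-> R})
    (w : T) : 'I_k -> 'M[R]_(M, n) :=
  fun i => \matrix_(a, b) G (i, a, b) w.

End random_variables.

Section solution_set.
Context {R : realType}.

Definition hypercube (n : nat) : set 'cV[R]_n :=
  [set s | forall a, s a 0 = -1 \/ s a 0 = 1].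

Definition inner (n : nat) (s t : 'cV[R]_n) : R := \sum_a s a 0 * t a 0.

(* The index of A is shifted by one against that of the tuples: A ord0 is the
   common matrix M_0 and A (lift ord0 i) the matrix attached to i : 'I_m. *)
Definition interpolate (m M n : nat) (A : 'I_m.+1 -> 'M[R]_(M, n))
    (i : 'I_m) (tau : R) : 'M[R]_(M, n) :=
  cos tau *: A ord0 + sin tau *: A (lift ord0 i).

(* On matrices `|_| is the entrywise sup norm. *)
Definition solutions (M n : nat) (K : R) (m : nat) (beta eta : R) (I : set R)
    (A : 'I_m.+1 -> 'M[R]_(M, n)) : set ('I_m -> 'cV[R]_n) :=
  [set sigma |
    [/\ forall i, hypercube (sigma i),
        forall i j : 'I_m, (i < j)%N ->
          beta - eta <= n%:R^-1 * inner (sigma i) (sigma j) <= beta &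
        exists tau : 'I_m -> R,
          (forall i, I (tau i)) /\
          \big[Num.max/0]_(i < m) `|interpolate A i (tau i) *m sigma i| <= K]].

End solution_set.

(* Main.v *)
Require Import Defs.
From HB Require Import structures.
From mathcomp Require Import all_boot all_order all_algebra.
From mathcomp Require Import finmap ring lra.
From mathcomp Require Import all_classical all_reals all_analysis.
From mathcomp Require Import measurable_realfun.

Set Implicit Arguments.
Unset Strict Implicit.
Unset Printing Implicit Defensive.

Import Order.TTheory GRing.Theory Num.Theory.
Import numFieldNormedType.Exports.

Local Open Scope classical_set_scope.
Local Open Scope ring_scope.

(** First moment method. For fixed sign vectors s_i with overlaps close to
beta and fixed times tau_i, the numbers (M_i(tau_i) s_i)_r are Gaussian with a
covariance matrix bounded below by n (1 - beta - m eta): the off-diagonal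
entries are at most n beta cos(tau_i) cos(tau_j) up to n eta. Hence they all
lie in [-K, K] with probability at most (C / n)^(m M / 2), which is
2^(- m n / (2 C1)) up to a factor 2^o(n), because M log2 n >= n / C1. The
number of tuples with overlaps at least beta - eta is at most 2^(2 n) when
beta is close enough to 1 in terms of m, and there are at most 2^n tuples of
times when c = 1 / m; so m >= 8 C1 suffices.

The Gaussian estimate avoids densities in R^L: the indicator of |Y| <= K is at
most exp (L/2 - |Y|^2 / (2 K^2)), and integrating out one Gaussian X with
coefficient vector a replaces exp (- v^T B^-1 v / 2) by
(det B / det (B + a a^T))^(1/2) exp (- v^T (B + a a^T)^-1 v / 2). *)

(** * Quadratic forms and determinants *)

Section quadratic_forms.
Context {R : realFieldType}.

Definition quad {n} (B : 'M[R]_n) (v : 'cV[R]_n) : R := (v^T *m B *m v) 0 0.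

(** The matrix inequality B >= k I for symmetric [B], phrased by quadratic forms so that no spectral
    theory enters. *)
Definition coercive {n} (k : R) (B : 'M[R]_n) :=
  B^T = B /\ forall v : 'cV[R]_n, k * quad 1%:M v <= quad B v.

Lemma quad1E {n} (v : 'cV[R]_n) : quad 1%:M v = \sum_i v i 0 ^+ 2.
Proof.
by rewrite /quad mulmx1 mxE; apply: eq_bigr => i _; rewrite mxE expr2.
Qed.

Lemma quad1_ge0 {n} (v : 'cV[R]_n) : 0 <= quad 1%:M v.
Proof. by rewrite quad1E sumr_ge0// => i _; rewrite sqr_ge0. Qed.

Lemma mx11_trmx (A : 'M[R]_1) : A^T = A.
Proof. by rewrite [A]mx11_scalar tr_scalar_mx. Qed.

Lemma quad_outer {n} (a v : 'cV[R]_n) :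
  quad (a *m a^T) v = ((a^T *m v) 0 0) ^+ 2.
Proof.
rewrite /quad !mulmxA -mulmxA mxE big_ord1 expr2; congr (_ * _).
by rewrite -[v^T *m a]mx11_trmx trmx_mul trmxK.
Qed.

Lemma quadD {n} (A B : 'M[R]_n) v : quad (A + B) v = quad A v + quad B v.
Proof. by rewrite /quad mulmxDr mulmxDl mxE. Qed.

Lemma quadZ {n} x (B : 'M[R]_n) v : quad (x *: B) v = x * quad B v.
Proof. by rewrite /quad -scalemxAr -scalemxAl mxE. Qed.

(** Induction on [n], splitting off the first row and column: the determinant is the corner entry
    [b], at least [k], times that of the Schur complement, which is again at least k I. *)
Lemma coercive_det {n} (k : R) (B : 'M[R]_n) :
  0 < k -> coercive k B -> k ^+ n <= \det B.
Proof.
move=> k0; elim: n B => [B _|n IH]; first by rewrite det_mx00.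
rewrite -[n.+1]/(1 + n)%N => B [Bt Bq].
pose b : R := B 0 0; pose u := dlsubmx B; pose C := drsubmx B.
have uT : ursubmx B = u^T by rewrite /u trmx_dlsub Bt.
have CT : C^T = C by rewrite /C trmx_drsub Bt.
have BE : B = block_mx b%:M u^T u C.
  rewrite -{1}(submxK B) uT; congr block_mx.
  by rewrite [LHS]mx11_scalar !mxE !lshift0.
have quadB (x : R) (v : 'cV[R]_n) : quad B (col_mx x%:M v) =
    b * x ^+ 2 + x * (u^T *m v) 0 0 *+ 2 + quad C v.
  rewrite /quad BE tr_col_mx mul_row_block mul_row_col !mulmxDl tr_scalar_mx.
  have -> : v^T *m u *m x%:M = x *: (u^T *m v).
    by rewrite mul_mx_scalar -[v^T *m u]mx11_trmx trmx_mul trmxK.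
  rewrite -!scalar_mxM !mul_scalar_mx -scalemxAl !mxE /= mulr1n; ring.
have quad1 (x : R) (v : 'cV[R]_n) :
    quad 1%:M (col_mx x%:M v) = x ^+ 2 + quad 1%:M v.
  rewrite /quad !mulmx1 tr_col_mx mul_row_col tr_scalar_mx -scalar_mxM.
  by rewrite !mxE /= mulr1n expr2.
have b0 : k <= b.
  have := Bq (col_mx 1%:M 0).
  rewrite quadB quad1 /quad !mulmx0 !mxE; lra.
have b1 : 0 < b by exact: lt_le_trans b0.
have bN0 : b != 0 by rewrite gt_eqF.
(* The Schur complement of b; it inherits the lower bound k. *)
pose S := C - b^-1 *: (u *m u^T).
have -> : \det B = b * \det S.
  have -> : B = block_mx 1%:M 0 (b^-1 *: u) 1%:M *m block_mx b%:M u^T 0 S.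
    rewrite BE mulmx_block !mul1mx !mul0mx !addr0 mul_mx_scalar scalerA.
    by rewrite divff// scale1r -scalemxAl /S addrC subrK.
  by rewrite det_mulmx det_lblock det_ublock !det1 !mul1r det_scalar1.
rewrite exprS ler_pM ?exprn_ge0 ?(ltW k0)//; apply: IH; split.
  by rewrite /S raddfB /= CT linearZ /= trmx_mul trmxK.
(* This [x] minimises the form over the first coordinate; the minimum is the form of [S] at [v]. *)
move=> v; pose x : R := - b^-1 * (u^T *m v) 0 0.
have := Bq (col_mx x%:M v); rewrite quadB quad1.
have -> : quad S v = quad C v - b^-1 * ((u^T *m v) 0 0) ^+ 2.
  by rewrite /S -scaleNr quadD quadZ quad_outer mulNr.
move=> H; have kx : 0 <= k * x ^+ 2 by rewrite mulr_ge0 ?sqr_ge0 ?(ltW k0).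
have : b * x ^+ 2 + x * (u^T *m v) 0 0 *+ 2 = - (b^-1 * ((u^T *m v) 0 0) ^+ 2).
  by rewrite /x; field.
lra.
Qed.

Lemma coercive_unit {n} (k : R) (B : 'M[R]_n) :
  0 < k -> coercive k B -> B \in unitmx.
Proof.
move=> k0 kB; rewrite unitmxE unitfE gt_eqF//.
by rewrite (lt_le_trans _ (coercive_det k0 kB))// exprn_gt0.
Qed.

Lemma coercive_outer {n} (k : R) (B : 'M[R]_n) (a : 'cV[R]_n) :
  coercive k B -> coercive k (B + a *m a^T).
Proof.
move=> [Bt Bq]; split; first by rewrite raddfD /= Bt trmx_mul trmxK.
by move=> v; rewrite quadD quad_outer (le_trans (Bq v))// lerDl sqr_ge0.
Qed.

(** The form of B^-1 at [a] is the form of [B] at B^-1 a. *)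
Lemma quad_inv_ge0 {n} (k : R) (B : 'M[R]_n) (a : 'cV[R]_n) :
  0 < k -> coercive k B -> 0 <= quad (invmx B) a.
Proof.
move=> k0 kB; have Bu := coercive_unit k0 kB; case: (kB) => Bt Bq.
have -> : quad (invmx B) a = quad B (invmx B *m a).
  by rewrite /quad trmx_mul trmx_inv Bt -!mulmxA mulKVmx.
by apply: le_trans (Bq _); rewrite mulr_ge0 ?quad1_ge0// ltW.
Qed.

(** Matrix determinant lemma: the bordered matrix [X] factors into block triangular matrices in two
    ways, one for each diagonal block eliminated. *)
Lemma det_add1_outer {n} (w a : 'cV[R]_n) :
  \det (1%:M + w *m a^T) = 1 + (a^T *m w) 0 0.
Proof.
pose X := block_mx (1%:M : 'M[R]_1) (- a^T) w (1%:M : 'M[R]_n).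
have X1 : X = block_mx 1%:M 0 w 1%:M *m block_mx 1%:M (- a^T) 0 (1%:M + w *m a^T).
  rewrite mulmx_block !mul1mx !mul0mx !mulmx1 ?mulmx0 !addr0 ?mulmxN.
  by rewrite addrC addrK.
have X2 : X = block_mx 1%:M (- a^T) 0 1%:M *m block_mx (1%:M + a^T *m w) 0 w 1%:M.
  rewrite mulmx_block !mul1mx !mul0mx ?mulmx1 ?mulmx0 ?add0r ?mulNmx.
  by rewrite addrK.
have := congr1 (fun M => \det M) X1; rewrite {1}X2 !det_mulmx.
rewrite !det_lblock !det_ublock !det1 !mul1r !mulr1 => <-.
by rewrite [_ + _]mx11_scalar det_scalar1 !mxE.
Qed.

Lemma det_outer {n} (B : 'M[R]_n) (a : 'cV[R]_n) : B \in unitmx ->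
  \det (B + a *m a^T) = \det B * (1 + quad (invmx B) a).
Proof.
move=> Bu; rewrite /quad -mulmxA -det_add1_outer -det_mulmx; congr (\det _).
by rewrite mulmxDr mulmx1 !mulmxA mulmxV// mul1mx.
Qed.

Definition bilin {n} (B : 'M[R]_n) (u v : 'cV[R]_n) : R := (u^T *m B *m v) 0 0.

(* Sherman-Morrison. *)
Lemma quad_inv_outer {n} (k : R) (B : 'M[R]_n) (a v : 'cV[R]_n) :
  0 < k -> coercive k B ->
  quad (invmx (B + a *m a^T)) v =
  quad (invmx B) v - bilin (invmx B) a v ^+ 2 / (1 + quad (invmx B) a).
Proof.
move=> k0 kB; have Bu := coercive_unit k0 kB; have [Bt _] := kB.
have al0 := quad_inv_ge0 a k0 kB.
set al := quad (invmx B) a in al0 *.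
pose w := invmx B *m a.
have wT : w^T = a^T *m invmx B by rewrite trmx_mul trmx_inv Bt.
have aw : a^T *m w = al%:M by rewrite /w mulmxA [LHS]mx11_scalar.
have al1 : 1 + al != 0 by rewrite gt_eqF// ltr_wpDr.
(* The formula is checked by multiplying both sides by B + a a^T. *)
have -> : invmx (B + a *m a^T) = invmx B - (1 + al)^-1 *: (w *m w^T).
  have U : B + a *m a^T \in unitmx by exact: coercive_unit k0 (coercive_outer a kB).
  apply: (can_inj (mulKmx U)); rewrite mulmxV// mulmxBr mulmxDl mulmxV//.
  rewrite -[a *m a^T *m invmx B]mulmxA -wT -scalemxAr mulmxDl [B *m _]mulmxA mulKVmx//.
  rewrite -[a *m a^T *m _]mulmxA [a^T *m _]mulmxA aw mul_scalar_mx -scalemxAr.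
  rewrite -{2}[a *m w^T]scale1r -scalerDl scalerA mulVf// scale1r addrK//.
by rewrite -scaleNr quadD quadZ quad_outer wT mulNr [_^-1 * _]mulrC.
Qed.

(** On the line v + x a the form is a quadratic polynomial in [x], the shape needed for a
    one-dimensional Gaussian integral. *)
Lemma quadDZ {n} (B : 'M[R]_n) (a v : 'cV[R]_n) (x : R) : B^T = B ->
  quad B (v + x *: a) = quad B a * x ^+ 2 + bilin B a v * x *+ 2 + quad B v.
Proof.
move=> Bt.
have vBa : v^T *m B *m a = a^T *m B *m v.
  by rewrite -[LHS]mx11_trmx !trmx_mul trmxK Bt mulmxA.
rewrite /quad /bilin [_^T]raddfD /= [(x *: a)^T]linearZ /= !mulmxDl !mulmxDr.
rewrite -!scalemxAl -!scalemxAr.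
rewrite vBa !mxE; ring.
Qed.

End quadratic_forms.

(** * Integrating out one Gaussian *)

Section independence.
Context {d d1 d' : measure_display} {T : measurableType d}.
Context {S : measurableType d1} {T' : measurableType d'}.
Context {R : realType} (P : probability T R).
Local Open Scope ereal_scope.

(** For fixed [A] both sides are finite measures in [B] ([m1] and [m2]), so agreement on a
    generating pi-system extends to all measurable sets. *)
Lemma indep_pi_system (X : {mfun T >-> S}) (V : T -> T') (G : set (set T')) :
  measurable_fun setT V -> measurable = <<s G >> -> setI_closed G -> G setT ->
  (forall A B, measurable A -> G B ->
    P (X @^-1` A `&` V @^-1` B) = P (X @^-1` A) * P (V @^-1` B)) ->
  forall A B, measurable A -> measurable B ->
    P (X @^-1` A `&` V @^-1` B) = P (X @^-1` A) * P (V @^-1` B).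
Proof.
move=> mV mG GI GT indep A B mA mB.
have mXA : measurable (X @^-1` A) by rewrite -[_ @^-1` _]setTI; exact: measurable_funP.
pose Vf : {mfun T >-> T'} := HB.pack V (isMeasurableFun.Build _ _ _ _ V mV).
pose m1 : {measure set T' -> \bar R} := pushforward (mrestr P mXA) V.
have PA0 : (0 <= fine (P (X @^-1` A)))%R by rewrite fine_ge0.
pose m2 : {measure set T' -> \bar R} := mscale (NngNum PA0) (distribution P Vf).
have m1m2 : m1 mV B = m2 B.
  apply: (measure_unique G (fun=> setT)) => //.
  - by rewrite bigcup_const.
  - move=> C GC; rewrite /m1 /m2 /=; rewrite /mscale /distribution /pushforward /mrestr /=.
    rewrite setIC indep//.
    by rewrite fineK// fin_num_measure.
  - move=> _; rewrite /m1 /=; rewrite /pushforward /mrestr /= preimage_setT setTI.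
    by rewrite (le_lt_trans (probability_le1 _ _))// ltry.
move: m1m2; rewrite /m1 /m2 /=; rewrite /mscale /distribution /pushforward /mrestr /=.
rewrite setIC => ->.
by rewrite fineK// fin_num_measure.
Qed.

(** Independence makes the joint law of [X] and [V] a product measure; Tonelli then integrates [X]
    first with [V] frozen. *)
Lemma indep_integral (X : {mfun T >-> S}) (V : T -> T') (f : S * T' -> \bar R) :
  measurable_fun setT V -> measurable_fun setT f -> (forall x, 0 <= f x) ->
  (forall A B, measurable A -> measurable B ->
    P (X @^-1` A `&` V @^-1` B) = P (X @^-1` A) * P (V @^-1` B)) ->
  \int[P]_w f (X w, V w) = \int[P]_w \int[distribution P X]_x f (x, V w).
Proof.
move=> mV mf f0 indep.
pose Vf : {mfun T >-> T'} := HB.pack V (isMeasurableFun.Build _ _ _ _ V mV).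
have mXV : measurable_fun setT (fun w => (X w, V w)) by exact: measurable_fun_pair.
pose XV : {mfun T >-> (S * T')%type} :=
  HB.pack (fun w => (X w, V w)) (isMeasurableFun.Build _ _ _ _ _ mXV).
transitivity (\int[distribution P XV]_z f z).
  by rewrite ge0_integral_pushforward.
transitivity (\int[distribution P X \x distribution P Vf]_z f z).
  apply: eq_measure_integral => C mC _; exact/esym/product_measure_unique.
rewrite fubini_tonelli2// /fubini_G.
rewrite ge0_integral_pushforward//=.
  exact: measurable_fun_fubini_tonelli_G.
by move=> y _; exact: integral_ge0.
Qed.

End independence.

(** * One-dimensional Gaussian integrals of exponentials of quadratics *)

Section gaussian_integral.
Context {R : realType}.
Notation mu := (@lebesgue_measure R).

(** The Radon-Nikodym derivative of [normal_prob] and [normal_pdf] have the same integral over every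
    measurable set, hence agree almost everywhere. *)
Lemma integral_normal_prob (m s : R) (f : R -> \bar R) :
  measurable_fun setT f -> (forall x, 0 <= f x)%E ->
  (\int[normal_prob m s]_x f x = \int[mu]_x (f x * (normal_pdf m s x)%:E))%E.
Proof.
move=> mf f0.
have dom := normal_prob_dominates m s.
rewrite -(Radon_Nikodym_SigmaFinite.change_of_variables dom)//.
have fi := Radon_Nikodym_SigmaFinite.f_integrable dom.
apply: ae_eq_integral => //.
- by apply: emeasurable_funM => //; exact: measurable_int fi.
- apply: emeasurable_funM => //; apply/measurable_EFinP.
  exact: measurable_normal_pdf.
- apply: ae_eqe_mul2l; apply: integral_ae_eq => //.
  + by apply/measurable_EFinP; exact: measurable_normal_pdf.
  + by move=> A _ mA; rewrite -Radon_Nikodym_SigmaFinite.f_integral.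
Qed.

Lemma integral_normal_expR_quadratic (al be c : R) : 0 <= al ->
  (\int[normal_prob 0 1]_x
      (expR (- (2^-1 * (al * x ^+ 2 + be * x *+ 2 + c))))%:E =
   ((Num.sqrt (1 + al))^-1 * expR (- (2^-1 * (c - be ^+ 2 / (1 + al)))))%:E)%E.
Proof.
move=> al0; have al1 : 0 < 1 + al by rewrite ltr_wpDr.
have al1N : 1 + al != 0 by rewrite gt_eqF.
(* [s] is the standard deviation of the Gaussian obtained by completing the square, and [C] the
   exponential left over. *)
set s := (Num.sqrt (1 + al))^-1; set C := expR (- (2^-1 * (c - _))).
have s0 : 0 < s by rewrite invr_gt0 sqrtr_gt0.
have s2 : s ^+ 2 = (1 + al)^-1 by rewrite exprVn sqr_sqrtr// ltW.
rewrite integral_normal_prob//; last first.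
  apply/measurable_EFinP; apply: measurableT_comp => //.
  apply: measurableT_comp => //; apply: measurable_funM => //.
  apply: measurable_funD => //; apply: measurable_funD => //.
    by apply: measurable_funM => //; exact: measurable_funX.
  by apply: measurable_funD; exact: measurable_funM.
(* Completing the square turns the integrand into a normal density. *)
transitivity (\int[mu]_x ((s * C)%:E * (normal_pdf (- (be / (1 + al))) s x)%:E))%E.
  apply: eq_integral => x _; rewrite -!EFinM; congr EFin.
  rewrite !normal_pdfE ?gt_eqF//.
  have -> : normal_peak s = s^-1 * normal_peak 1 :> R.
    rewrite /normal_peak expr1n mul1r -mulrnAr sqrtrM ?sqr_ge0//.
    by rewrite sqrtr_sqr gtr0_norm// invfM.
  have E : expR (- (2^-1 * (al * x ^+ 2 + be * x *+ 2 + c))) * normal_fun 0 1 x =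
      C * normal_fun (- (be / (1 + al))) s x.
    rewrite /normal_fun /C -!expRD; congr expR; rewrite s2; field; lra.
  by rewrite mulrCA E; field; rewrite gt_eqF.
rewrite ge0_integralZl//; first by rewrite integral_normal_pdf mule1.
- by apply/measurable_EFinP; exact: measurable_normal_pdf.
- by move=> x _; rewrite lee_fin normal_pdf_ge0.
- by rewrite lee_fin mulr_ge0 ?expR_ge0// ltW.
Qed.

(** One step of the recursion: the constants 1 + al and c - be^2 / (1 + al) of the scalar integral
    are recognised through [det_outer] and [quad_inv_outer]. *)
Lemma integral_normal_quad n (k : R) (B : 'M[R]_n) (a v : 'cV[R]_n) :
  0 < k -> coercive k B ->
  (\int[normal_prob 0 1]_x (expR (- (2^-1 * quad (invmx B) (v + x *: a))))%:E =
   (Num.sqrt (\det B / \det (B + a *m a^T)) *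
    expR (- (2^-1 * quad (invmx (B + a *m a^T)) v)))%:E)%E.
Proof.
move=> k0 kB; have [Bt _] := kB.
have al0 := quad_inv_ge0 a k0 kB.
under eq_integral do rewrite quadDZ ?trmx_inv ?Bt//.
rewrite integral_normal_expR_quadratic// (quad_inv_outer _ _ k0)//.
have Bu := coercive_unit k0 kB.
rewrite det_outer// invfM mulrA divff ?mul1r -?unitfE -?unitmxE// sqrtrV//.
by rewrite ltW// ltr_wpDr.
Qed.

End gaussian_integral.

(** * Independence of one variable from all the others *)

Section other_variables.
Context {d : measure_display} {T : measurableType d} {R : realType}.
Context {P : probability T R} {E : finType} (X : E -> {RV P >-> R}).

(* A pi-system generating the sigma-algebra of the variables other than X e. *)
Definition other_rectangles (e : E) : set (set T) :=
  [set D | exists2 B : E -> set R, forall i, measurable (B i) &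
    D = \bigcap_(i in [set` [set~ e]%SET]) (X i @^-1` B i)].

Lemma measurable_RV_preimage (e : E) (A : set R) :
  measurable A -> measurable (X e @^-1` A).
Proof. by move=> mA; rewrite -[_ @^-1` _]setTI; exact: measurable_funP. Qed.

Lemma other_rectangles_measurable e D : other_rectangles e D -> measurable D.
Proof.
move=> [B mB ->]; apply: fin_bigcap_measurable => // i _.
exact: measurable_RV_preimage.
Qed.

(** The sigma-algebra of the other variables is a second measurable structure on [T], and [id] is
    the random element with values in it; independence of [X e] from the rest is then independence
    of two maps. *)
Lemma measurable_others e :
  measurable_fun setT (id : T -> g_sigma_algebraType (other_rectangles e)).
Proof.
move=> _ D mD; rewrite setTI preimage_id.
move: D mD; apply: smallest_sub; first exact: sigma_algebra_measurable.
exact: other_rectangles_measurable.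
Qed.

Lemma measurable_other e i : i != e ->
  measurable_fun setT (X i : g_sigma_algebraType (other_rectangles e) -> R).
Proof.
move=> ie _ A mA; rewrite setTI; apply: sub_sigma_algebra.
exists (fun j => if j == i then A else setT); first by move=> j; case: ifP.
apply/seteqP; split => [w Aw j /= _|w /(_ i)]; first by case: eqP => [->|].
by rewrite /= eqxx; apply; rewrite !inE.
Qed.

Lemma others_independent e : mutually_independent X ->
  forall A (B : set (g_sigma_algebraType (other_rectangles e))),
  measurable A -> measurable B ->
  (P (X e @^-1` A `&` id @^-1` B) = P (X e @^-1` A) * P (id @^-1` B))%E.
Proof.
move=> indX; pose T' := g_sigma_algebraType (other_rectangles e).
apply: (@indep_pi_system _ _ _ _ _ T' _ P (X e) (id : T -> T')
  (other_rectangles e)) => //.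
- exact: measurable_others.
- move=> _ _ [B1 mB1 ->] [B2 mB2 ->].
  exists (fun i => B1 i `&` B2 i); first by move=> i; exact: measurableI.
  by rewrite -bigcapI; apply: eq_bigcapr.
- exists (fun=> setT) => //; apply/seteqP; split => // w _ i _.
- move=> A D mA [B mB ->]; rewrite preimage_id.
  (* Putting [A] at the index [e] merges both events into one rectangle over all indices; mutual
     independence is applied to it and to the rectangle without [e]. *)
  pose B' i := if i == e then A else B i.
  have mB' i : measurable (B' i) by rewrite /B'; case: ifP.
  have eB' i : i \in [set~ e]%SET -> B' i = B i.
    by rewrite !inE /B' => /negbTE ->.
  have -> : \bigcap_(i in [set` [set~ e]%SET]) (X i @^-1` B i) =
      \bigcap_(i in [set` [set~ e]%SET]) (X i @^-1` B' i).
    by apply: eq_bigcapr => i ie; rewrite eB'.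
  have {1}-> : A = B' e by rewrite /B' eqxx.
  rewrite [in RHS]indX// [in RHS](_ : P (X e @^-1` _) = P (X e @^-1` B' e))//.
  transitivity (\prod_(i in [set: E]%SET) P (X i @^-1` B' i))%E; last first.
    rewrite (bigD1 e) ?inE//=; congr (_ * _)%E.
    by apply: eq_bigl => i; rewrite !inE.
  rewrite -indX//; congr (P _); apply/seteqP; split => [w [? H] i _|w H].
    by have [->//|ie] := eqVneq i e; apply: H; rewrite /= !inE.
    by split=> [|i _]; apply: H; rewrite /= inE.
  by rewrite /B' eqxx.
Qed.

End other_variables.

(* [distribution P X] and [normal_prob] live on copies of R with the same
   sigma-algebra but different displays, hence the pushforward along [idf]. *)
Lemma integral_standard_normal d (T : measurableType d) (R : realType) (P : probability T R)
    (X : {RV P >-> R}) (f : R -> \bar R) :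
  standard_normal X -> measurable_fun setT f -> (forall x, 0 <= f x)%E ->
  (\int[distribution P X]_x f x = \int[normal_prob 0 1]_x f x)%E.
Proof.
move=> nX mf f0.
have mid : @measurable_fun _ _ R (measurableTypeR R) setT id.
  by move=> _ A mA; rewrite setTI.
pose idf : {mfun R >-> measurableTypeR R} :=
  HB.pack (id : R -> measurableTypeR R)
    (isMeasurableFun.Build _ _ R (measurableTypeR R) _ mid).
transitivity (\int[distribution (distribution P X) idf]_x f x)%E; last first.
  by apply: eq_measure_integral => A mA _; exact: nX.
by rewrite (@ge0_integral_pushforward _ _ R (measurableTypeR R)).
Qed.

(** * Exponential moments of quadratic forms in Gaussian vectors *)

Section quadratic_expectation.
Context {d : measure_display} {T : measurableType d} {R : realType}.

Lemma measurable_expR_quad d' (U : measurableType d') n (B : 'M[R]_n)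
    (F : U -> 'cV[R]_n) :
  (forall i, measurable_fun setT (fun u => F u i 0)) ->
  measurable_fun setT (fun u => (expR (- (2^-1 * quad B (F u))))%:E).
Proof.
move=> mF; apply/measurable_EFinP; apply: measurableT_comp => //.
apply: measurableT_comp => //; apply: measurable_funM => //.
under eq_fun do rewrite /quad mxE.
apply: measurable_sum => j; apply: measurable_funM => //.
under eq_fun do rewrite mxE.
apply: measurable_sum => i; apply: measurable_funM => //.
under eq_fun do rewrite mxE.
exact: mF.
Qed.

Context {P : probability T R} {E : finType} (X : E -> {RV P >-> R}).
Hypotheses (indX : mutually_independent X) (normX : forall e, standard_normal (X e)).

(** Induction on [s] for all [B] at once: integrating out the head turns [B] into B + a a^T, and the
    determinant ratios telescope. *)
Lemma expectation_expR_quad n (a : E -> 'cV[R]_n) (k : R) (B : 'M[R]_n) (s : seq E) :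
  0 < k -> coercive k B -> uniq s ->
  (\int[P]_w (expR (- (2^-1 * quad (invmx B) (\sum_(e <- s) X e w *: a e))))%:E =
   (Num.sqrt (\det B / \det (B + \sum_(e <- s) a e *m (a e)^T)))%:E)%E.
Proof.
move=> k0; elim: s B => [|e s IH] B kB /=.
  move=> _; have Bu := coercive_unit k0 kB.
  under eq_integral do rewrite big_nil /quad mulmx0 mxE mulr0 oppr0 expR0.
  rewrite integral_cst//= probability_setT mule1 big_nil addr0 divff ?sqrtr1//.
  by rewrite -unitfE -unitmxE.
move=> /andP[es us].
pose T' := g_sigma_algebraType (other_rectangles X e).
(* The first coordinate stands for [X e]; the remaining variables are read off the coarser space
   [T']. *)
pose f (z : R * T') : \bar R := (expR (- (2^-1 *
  quad (invmx B) (\sum_(i <- s) X i z.2 *: a i + z.1 *: a e))))%:E.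
transitivity (\int[P]_w f (X e w, id w))%E.
  by apply: eq_integral => w _; rewrite /f big_cons addrC.
rewrite (indep_integral (V := (id : T -> T')))//.
- transitivity (\int[P]_w ((Num.sqrt (\det B / \det (B + a e *m (a e)^T)))%:E *
    (expR (- (2^-1 * quad (invmx (B + a e *m (a e)^T))
       (\sum_(i <- s) X i w *: a i))))%:E))%E.
    apply: eq_integral => w _; rewrite -EFinM -(integral_normal_quad _ _ k0)//.
    rewrite integral_standard_normal//; last by move=> x; rewrite lee_fin expR_ge0.
    apply: measurable_expR_quad => i; under eq_fun do rewrite !mxE /=.
    by apply: measurable_funD => //; exact: measurable_funM.
  rewrite ge0_integralZl//.
  + rewrite IH//; last exact: coercive_outer.
    have det_gt0 D : coercive k D -> 0 < \det D.
      by move=> kD; rewrite (lt_le_trans _ (coercive_det k0 kD))// exprn_gt0.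
    have kBe := coercive_outer (a e) kB.
    rewrite -EFinM -sqrtrM ?divr_ge0 ?ltW ?det_gt0// big_cons addrA.
    by congr (Num.sqrt _)%:E; rewrite mulrA divfK// gt_eqF// det_gt0.
  + apply: measurable_expR_quad => i; under eq_fun do rewrite summxE.
    apply: measurable_sum => j; under eq_fun do rewrite mxE.
    exact: measurable_funM.
- exact: measurable_others.
- apply: measurable_expR_quad => i; under eq_fun do rewrite mxE summxE mxE.
  apply: measurable_funD; last by apply: measurable_funM.
  (* [X e] need not be measurable on [T'], so its term is set to 0; the sum over [s] is unchanged
     because [e] is not in [s]. *)
  pose Y j z := if j == e then 0 else X j z * a j i 0.
  have -> : (fun z : R * T' => \sum_(j <- s) (X j z.2 *: a j) i 0) =
      (fun z => \sum_(j <- s) Y j z) \o snd.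
    apply/funext => z /=; apply: eq_big_seq => j js; rewrite mxE /Y.
    by case: eqP js es => // -> ->.
  apply: (@measurableT_comp _ _ _ _ _ _ (fun z : T' => \sum_(j <- s) Y j z)) => //.
  apply: measurable_sum => j; rewrite /Y; case: eqP => // /eqP je.
  by apply: measurable_funM => //; exact: measurable_other.
- by move=> z; rewrite /f lee_fin expR_ge0.
- exact: others_independent.
Qed.

End quadratic_expectation.

(** * Small-ball estimate for Gaussian linear forms *)

Section small_ball.
Context {d : measure_display} {T : measurableType d} {R : realType}.
Context {P : probability T R} {I E : finType} (X : E -> {RV P >-> R}).

Lemma measurable_linear_ball (a : I -> E -> R) (K : R) :
  measurable [set w | forall i, `|\sum_e a i e * X e w| <= K].
Proof.
have -> : [set w | forall i, `|\sum_e a i e * X e w| <= K] =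
    \bigcap_(i in [set: I]) ((fun w => `|\sum_e a i e * X e w|) @^-1` `]-oo, K]).
  apply/seteqP; split => [w H i _|w H i]; first by rewrite /= in_itv /=.
  by have := H i Logic.I; rewrite /= in_itv.
apply: fin_bigcap_measurable => // i _; rewrite -[_ @^-1` _]setTI.
have : measurable_fun setT (fun w => `|\sum_e a i e * X e w|).
  apply: measurableT_comp => //; apply: measurable_sum => e.
  by apply: measurable_funM.
by apply => //; exact: measurable_itv.
Qed.

(** Exponential Markov bound with B = K^2 I: the expectation is (det B / det (B + A))^(1/2), at most
    (K^2 / delta)^(n/2), and the prefactor exp (n/2) gives [expR 1] under the root. *)
Lemma gaussian_small_ball (a : I -> E -> R) (K delta : R) :
  mutually_independent X -> (forall e, standard_normal (X e)) ->
  0 < K -> 0 < delta ->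
  (forall v : I -> R,
    delta * \sum_i v i ^+ 2 <= \sum_e (\sum_i v i * a i e) ^+ 2) ->
  (P [set w | forall i, (`|\sum_e a i e * X e w| <= K)%R] <=
   (Num.sqrt (expR 1 * K ^+ 2 / delta) ^+ #|I|)%:E)%E.
Proof.
move=> indX normX K0 delta0 Ha.
pose n := #|I|; pose av e : 'cV[R]_n := \col_l a (enum_val l) e.
have K20 : 0 < K ^+ 2 by rewrite exprn_gt0.
pose B : 'M[R]_n := (K ^+ 2)%:M.
have quadB v : quad B v = K ^+ 2 * quad 1%:M v.
  by rewrite -quadZ scalemx1.
have kB : coercive (K ^+ 2) B.
  by split; [rewrite tr_scalar_mx|move=> v; rewrite quadB].
pose A := \sum_(e <- enum E) av e *m (av e)^T.
have quadA v : quad A v = \sum_e ((av e)^T *m v) 0 0 ^+ 2.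
  rewrite /A -big_enum /=; elim: (enum E) => [|e s IH].
    by rewrite !big_nil /quad mulmx0 mul0mx mxE.
  by rewrite !big_cons quadD IH quad_outer.
have AT : A^T = A.
  rewrite /A raddf_sum /=; apply: eq_bigr => e _.
  by rewrite trmx_mul trmxK.
have kBA : coercive (K ^+ 2 + delta) (B + A).
  split; first by rewrite raddfD /= AT tr_scalar_mx.
  move=> v; rewrite quadD quadB mulrDl lerD2l quadA quad1E.
  have := Ha (fun i => v (enum_rank i) 0).
  rewrite [X in delta * X](reindex (@enum_val I I)) /=; last first.
    by apply: onW_bij; exact: enum_val_bij.
  under eq_bigr do rewrite enum_valK.
  congr (_ <= _); apply: eq_bigr => e _; congr (_ ^+ 2).
  rewrite (reindex (@enum_val I I)) /=; last first.
    by apply: onW_bij; exact: enum_val_bij.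
  by rewrite mxE; apply: eq_bigr => l _; rewrite !mxE enum_valK mulrC.
have KN0 : K ^+ 2 != 0 by rewrite gt_eqF.
have Binv : invmx B = (K ^- 2)%:M.
  by rewrite invmx_scalar.
have EE := expectation_expR_quad indX normX av K20 kB (enum_uniq E).
rewrite -/A Binv in EE.
have mE : measurable_fun setT (fun w => (expR (- (2^-1 * quad (K ^- 2)%:M
    (\sum_(e <- enum E) X e w *: av e))))%:E).
  apply: measurable_expR_quad => l; under eq_fun do rewrite summxE.
  apply: measurable_sum => e; under eq_fun do rewrite mxE.
  exact: measurable_funM.
have mS := measurable_linear_ball a K.
set S := [set w | _] in mS *.
rewrite -[S]setIT -integral_indic//.
(* On [S] each of the [n] squares is at most K^2, so n/2 - |Y|^2 / (2 K^2) is nonnegative; off [S]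
   the indicator vanishes. *)
apply: (@le_trans _ _ (\int[P]_w ((expR (2^-1 * n%:R))%:E * (expR (- (2^-1 *
    quad (K ^- 2)%:M (\sum_(e <- enum E) X e w *: av e))))%:E)))%E.
  apply: ge0_le_integral => //.
  - by apply/measurable_EFinP; exact: measurable_indic.
  - exact: emeasurable_funM.
  - move=> w _; rewrite -EFinM lee_fin indicE -expRD.
    case: (boolP (w \in S)) => [|_]; last by rewrite expR_ge0.
    rewrite inE => Sw; rewrite -[X in X <= _]expR0 ler_expR.
    rewrite -mulrBr mulr_ge0// subr_ge0 -scalemx1 quadZ quad1E.
    rewrite mulrC ler_pdivrMr// [leRHS](_ : _ = \sum_(l < n) K ^+ 2); last first.
      by rewrite sumr_const card_ord mulr_natl.
    apply: ler_sum => l _; rewrite summxE big_enum /=.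
    rewrite -[leLHS]real_normK ?num_real// ler_pXn2r ?nnegrE ?(ltW K0)//.
    apply: le_trans (Sw (enum_val l)); rewrite le_eqVlt; apply/orP; left.
    by apply/eqP; congr (`|_|); apply: eq_bigr => e _; rewrite !mxE mulrC.
rewrite ge0_integralZl//.
rewrite EE -EFinM lee_fin.
have K2d : 0 < K ^+ 2 + delta by rewrite addr_gt0.
have detBA := coercive_det K2d kBA.
have detBA0 : 0 < \det (B + A) by rewrite (lt_le_trans _ detBA)// exprn_gt0.
(* Squaring removes the roots; what remains is delta^n <= det (B + A), through (K^2 + delta)^n. *)
rewrite -(@ler_pXn2r _ 2)// ?nnegrE ?mulr_ge0 ?exprn_ge0 ?expR_ge0 ?sqrtr_ge0//.
rewrite -exprM mulnC exprM sqr_sqrtr; last first.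
  by rewrite divr_ge0 ?mulr_ge0 ?expR_ge0// ltW.
rewrite exprMn sqr_sqrtr; last by rewrite det_scalar divr_ge0 ?exprn_ge0// ltW.
have -> : expR (2^-1 * n%:R) ^+ 2 = expR 1 ^+ n :> R.
  by rewrite -!expRM_natl mulr1 mulrA mulfV ?mul1r.
rewrite det_scalar.
rewrite -/n [(_ / delta) ^+ _]exprMn [(expR 1 * _) ^+ _]exprMn exprVn -mulrA.
rewrite ler_pM2l ?exprn_gt0 ?expR_gt0// ler_pM2l ?exprn_gt0//.
rewrite lef_pV2 ?posrE ?exprn_gt0//; apply: le_trans detBA.
by rewrite lerXn2r ?nnegrE ?ltW// ltrDr.
Qed.

End small_ball.

(** * Overlaps of sign vectors *)

Section gram.
Context {R : realType}.

(** The Gram matrix is n (beta J + (1 - beta) I), with [J] the all-ones matrix, up to off-diagonal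
    errors of at most n eta. The [J] part is nonnegative and is dropped; the errors cost at most m
    eta by x y <= (x^2 + y^2) / 2. *)
Lemma gram_lower_bound m n (s : 'I_m -> 'I_n -> R) (beta eta : R) (x : 'I_m -> R) :
  (forall i b, s i b ^+ 2 = 1) -> 0 <= beta -> 0 <= eta ->
  (forall i j, i != j ->
    n%:R * (beta - eta) <= \sum_b s i b * s j b <= n%:R * beta) ->
  n%:R * (1 - beta - m%:R * eta) * \sum_i x i ^+ 2 <=
  \sum_b (\sum_i x i * s i b) ^+ 2.
Proof.
move=> s2 beta0 eta0 hs.
have -> : \sum_b (\sum_i x i * s i b) ^+ 2 =
    \sum_i \sum_j x i * x j * \sum_b s i b * s j b.
  under eq_bigr do rewrite expr2 big_distrlr /=.
  rewrite exchange_big /=; apply: eq_bigr => i _.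
  rewrite exchange_big /=; apply: eq_bigr => j _.
  rewrite mulr_sumr; apply: eq_bigr => b _; ring.
pose lo i j := n%:R * (beta * (x i * x j) + (i == j)%:R * (1 - beta) * x i ^+ 2
  - eta * (x i ^+ 2 + x j ^+ 2) / 2).
have Hlo i j : lo i j <= x i * x j * \sum_b s i b * s j b.
  rewrite /lo; have [<-|ij] := eqVneq i j.
        under eq_bigr do rewrite -expr2 s2.
    rewrite sumr_const card_ord -[leRHS]mulrC ler_wpM2l ?ler0n//.
    have : 0 <= eta * (x i ^+ 2) by rewrite mulr_ge0 ?sqr_ge0.
    by rewrite mulr1n mul1r -expr2; lra.
  set S := \sum_b _; have /andP[S1 S2] := hs i j ij; rewrite -/S in S1 S2.
  have n0 : 0 <= n%:R :> R by rewrite ler0n.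
  (* Half the sum of [H1] and [H2] is exactly the gap between the two sides, whatever the sign of
     x_i x_j. *)
  have H1 : 0 <= (n%:R * beta - S) * (x i - x j) ^+ 2.
    by rewrite mulr_ge0 ?sqr_ge0// subr_ge0.
  have H2 : 0 <= (n%:R * eta - (n%:R * beta - S)) * (x i ^+ 2 + x j ^+ 2).
    by apply: mulr_ge0; [lra|rewrite addr_ge0 ?sqr_ge0].
  rewrite mulr0n !mul0r addr0 -subr_ge0.
  have -> : x i * x j * S - n%:R * (beta * (x i * x j) -
      eta * (x i ^+ 2 + x j ^+ 2) / 2) =
    2^-1 * ((n%:R * beta - S) * (x i - x j) ^+ 2 +
      (n%:R * eta - (n%:R * beta - S)) * (x i ^+ 2 + x j ^+ 2)) by field.
  by rewrite mulr_ge0 ?addr_ge0// invr_ge0.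
apply: le_trans (ler_sum _ (fun i _ => ler_sum _ (fun j _ => Hlo i j))).
have sum_cross : \sum_i \sum_j beta * (x i * x j) = beta * (\sum_i x i) ^+ 2.
  rewrite expr2 big_distrlr mulr_sumr; apply: eq_bigr => i _.
  by rewrite mulr_sumr.
have sum_diag : \sum_(i < m) \sum_(j < m) (i == j)%:R * (1 - beta) * x i ^+ 2 =
    (1 - beta) * \sum_i x i ^+ 2.
  rewrite mulr_sumr; apply: eq_bigr => i _.
  rewrite (bigD1 i)//= eqxx mul1r big1 ?addr0// => j ij.
  by rewrite eq_sym (negbTE ij) !mul0r.
have sum_err : \sum_(i < m) \sum_(j < m) - (eta * (x i ^+ 2 + x j ^+ 2) / 2) =
    - (m%:R * eta * \sum_i x i ^+ 2).
  under eq_bigr do rewrite sumrN -mulr_suml -mulr_sumr big_split /= sumr_const card_ord.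
  rewrite sumrN -mulr_suml -mulr_sumr big_split /= sumr_const card_ord.
  by rewrite sumrMnl -mulr_natr; field.
have -> : \sum_(i < m) \sum_(j < m) lo i j =
  n%:R * (beta * (\sum_i x i) ^+ 2 + (1 - beta - m%:R * eta) * \sum_i x i ^+ 2).
  under eq_bigr do rewrite -mulr_sumr !big_split /=.
  by rewrite -mulr_sumr !big_split /= sum_cross sum_diag sum_err; ring.
by rewrite -mulrA ler_wpM2l ?ler0n// lerDr mulr_ge0 ?sqr_ge0.
Qed.

End gram.

(** * Counting tuples of sign vectors with large overlaps *)

Section counting.
Context {R : realType}.

(** Signs are coded by booleans so that tuples of sign vectors form a finite type. *)
Definition spin (b : bool) : R := if b then 1 else -1.

Definition overlap n (f g : {ffun 'I_n -> bool}) : R := \sum_b spin (f b) * spin (g b).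

Lemma spin_sqr b : spin b ^+ 2 = 1.
Proof. by rewrite /spin; case: b; rewrite ?sqrrN expr1n. Qed.

(** The exponential factors over coordinates, and the sum over both signs of one coordinate does not
    depend on [g]. *)
Lemma sum_expR_overlap n (la : R) (g : {ffun 'I_n -> bool}) :
  \sum_h expR (la * overlap g h) = (expR la + expR (- la)) ^+ n.
Proof.
under eq_bigr do rewrite /overlap mulr_sumr expR_sum.
rewrite -(bigA_distr_bigA (fun b c => expR (la * (spin (g b) * spin c)))) /=.
rewrite -[in RHS](card_ord n) -prodr_const; apply: eq_bigr => b _.
rewrite big_bool /= /spin; case: (g b); rewrite ?mul1r ?mulN1r ?opprK ?mulr1 ?mulrN1//.
by rewrite addrC.
Qed.

(* Each such tuple f contributes at least 1, through g = f 0, to the sum over all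
   g and f of the products of the weights exp (la * (overlap g (f i) - r)). *)
Lemma card_overlaps_ge m n (la r : R) : 0 <= la -> (0 < m)%N -> r <= n%:R ->
  #|[pred f : {ffun 'I_m -> {ffun 'I_n -> bool}} |
      [forall i : 'I_m, forall j : 'I_m, (i < j)%N ==> (r <= overlap (f i) (f j))]]|%:R <=
  2 ^+ n * (((expR la + expR (- la)) ^+ n * expR (- (la * r))) ^+ m) :> R.
Proof.
move=> la0 m0 rn.
pose w (g h : {ffun 'I_n -> bool}) := expR (la * (overlap g h - r)).
have -> : 2 ^+ n * (((expR la + expR (- la)) ^+ n * expR (- (la * r))) ^+ m) =
    \sum_g \sum_(f : {ffun 'I_m -> {ffun 'I_n -> bool}}) \prod_i w g (f i).
  transitivity (\sum_(g : {ffun 'I_n -> bool})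
      ((expR la + expR (- la)) ^+ n * expR (- (la * r))) ^+ m).
    by rewrite sumr_const card_ffun card_bool card_ord -natrX mulr_natl.
  apply: eq_bigr => g _; rewrite -(bigA_distr_bigA (fun=> w g)) /=.
  rewrite prodr_const card_ord; congr (_ ^+ _).
  rewrite -(sum_expR_overlap la g) mulr_suml; apply: eq_bigr => h _.
  by rewrite -expRD /w mulrBr.
rewrite exchange_big /= -sum1_card natr_sum.
rewrite [leRHS](bigID (fun f : {ffun 'I_m -> {ffun 'I_n -> bool}} =>
   [forall i : 'I_m, forall j : 'I_m, (i < j)%N ==> (r <= overlap (f i) (f j))]))/=.
apply: ler_wpDr.
  by do 2![apply: sumr_ge0 => ? _]; apply: prodr_ge0 => ? _; exact: expR_ge0.
apply: ler_sum => f Hf; pose i0 : 'I_m := Ordinal m0.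
rewrite (bigD1 (f i0))//=; apply: ler_wpDr.
  by apply: sumr_ge0 => ? _; apply: prodr_ge0 => ? _; exact: expR_ge0.
rewrite [leLHS](_ : _ = \prod_(i < m) 1); last by rewrite big1_eq.
apply: ler_prod => i _; rewrite ler01 /= -expR0 ler_expR mulr_ge0// subr_ge0.
(* For i = 0 the overlap of f 0 with itself is [n], at least [r]; otherwise the pair (0, i) is
   constrained. *)
have [i00|ii0] := eqVneq i i0.
  rewrite i00 /overlap; under eq_bigr do rewrite -expr2 spin_sqr.
  by rewrite sumr_const card_ord.
have lt0i : (i0 < i)%N.
  by rewrite lt0n; apply: contra_neq ii0 => i00; apply: val_inj.
by have /forallP/(_ i0)/forallP/(_ i)/implyP/(_ lt0i) := Hf.
Qed.

End counting.

(** * Choice of parameters and asymptotics in n *)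

Section parameters.
Context {R : realType}.

Lemma pow2E (x : R) : 2 `^ x = expR (x * ln 2).
Proof. by rewrite /powR pnatr_eq0. Qed.

Lemma ln2_gt0 : 0 < ln 2 :> R.
Proof. by rewrite ln_gt0// ltr1n. Qed.

(** The left side is (1 + exp (-2 la)) exp (la (1 - rho)). With la = 1 / (2 h) the first factor is
    at most 1 + h, and theta <= h^2 makes the second at most exp h. The cap 1/4 on [theta] later
    gives eta < beta. *)
Lemma exists_entropy_parameters (h : R) : 0 < h ->
  exists la theta : R, [/\ 0 <= la, 0 < theta, theta <= 4^-1 &
    forall rho, 1 - 2 * theta <= rho ->
      (expR la + expR (- la)) * expR (- (la * rho)) <= expR (2 * h)].
Proof.
move=> h0; pose la := (2 * h)^-1; pose theta := Num.min 4^-1 (h ^+ 2).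
have la0 : 0 < la by rewrite invr_gt0 mulr_gt0.
exists la, theta; split.
- exact: ltW.
- by rewrite lt_min invr_gt0 ltr0n exprn_gt0.
- by rewrite ge_min lexx.
move=> rho Hrho.
have laE : la * (2 * h) = 1 by rewrite mulVf// gt_eqF// mulr_gt0.
have th : theta <= h ^+ 2 by rewrite ge_min lexx orbT.
have -> : expR la + expR (- la) = expR la * (1 + expR (- (2 * la))).
  by rewrite mulrDr mulr1 -expRD; congr (_ + expR _); ring.
have -> : expR la * (1 + expR (- (2 * la))) * expR (- (la * rho)) =
   (1 + expR (- (2 * la))) * expR (la * (1 - rho)).
  by rewrite mulrC mulrA -expRD mulrC; congr (_ * expR _); ring.
rewrite [2 * h]mulr_natl mulr2n expRD ler_pM ?addr_ge0 ?expR_ge0//.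
  apply: le_trans (expR_ge1Dx h); rewrite lerD2l expRN.
  rewrite -[leRHS]invrK lef_pV2 ?posrE ?expR_gt0 ?invr_gt0//.
  apply: le_trans (expR_ge1Dx _).
  have -> : h^-1 = 2 * la by rewrite /la invfM mulrA mulfV ?mul1r.
  by rewrite lerDr.
rewrite ler_expR; apply: (@le_trans _ _ (la * (2 * h ^+ 2))).
  by rewrite ler_pM2l//; lra.
by rewrite expr2 !mulrA -[la * 2 * h]mulrA laE mul1r.
Qed.

Lemma nat_ln_large (X : R) : exists M0 : nat, forall M : nat, (M0 <= M)%N ->
  [/\ (0 < M)%N & X <= ln M%:R].
Proof.
exists (Num.trunc (expR X)).+1 => M HM; have M0 : (0 < M)%N by exact: leq_trans HM.
split=> //; rewrite -[X]expRK ler_ln ?posrE ?expR_gt0 ?ltr0n//.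
by rewrite (le_trans (ltW (truncnS_gt _)))// ler_nat.
Qed.

(** The logarithm is (m M / 2) (ln D - ln n). Since ln n >= ln M and m >= 8 C1, the second term
    gives at most - 4 n ln 2; the first costs at most n ln 2 / 2. *)
Lemma small_ball_asymptotics (C1 c2 D : R) (m : nat) :
  0 < c2 -> 0 < C1 -> 0 < D -> 8 * C1 <= m%:R ->
  exists M0 : nat, forall M n : nat, (M0 <= M)%N ->
    c2 * M%:R * log2 (M%:R) <= n%:R <= C1 * M%:R * log2 (M%:R) ->
    (0 < n)%N /\
    Num.sqrt (D / n%:R) ^+ (m * M) <= expR (- (7 / 2 * n%:R * ln 2)).
Proof.
move=> c20 C10 D0 Cm; have l20 := ln2_gt0.
(* The three summands ensure in turn that ln M > 0, that n >= M, and that m M |ln D| <= n ln 2. *)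
have [M0 HM0] := nat_ln_large (1 + ln 2 / c2 + m%:R * `|ln D| / c2).
exists M0 => M n /HM0[M_gt0 Hl] /andP[Hn1 Hn2]; rewrite /log2 in Hn1 Hn2.
have MR0 : 0 < M%:R :> R by rewrite ltr0n.
set l := ln M%:R in Hl Hn1 Hn2; set y := ln 2 in l20 Hl Hn1 Hn2 *.
have A1 : 0 <= y / c2 by rewrite divr_ge0// ltW.
have A2 : 0 <= m%:R * `|ln D| / c2 by rewrite divr_ge0 ?mulr_ge0// ltW.
have l0 : 0 < l by lra.
have yl : y <= c2 * l by rewrite -ler_pdivrMl// mulrC; lra.
have dl : m%:R * `|ln D| <= c2 * l by rewrite -ler_pdivrMl// mulrC; lra.
have n1 : c2 * l * M%:R <= n%:R * y.
  by rewrite -ler_pdivrMr// (le_trans _ Hn1)// le_eqVlt; apply/orP; left; apply/eqP; ring.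
have n2 : n%:R * y <= C1 * M%:R * l.
  by rewrite -ler_pdivlMr// (le_trans Hn2)// le_eqVlt; apply/orP; left; apply/eqP; ring.
have nM : M%:R <= n%:R :> R.
  rewrite -(ler_pM2r l20); apply: le_trans n1.
  by rewrite [leLHS]mulrC ler_pM2r.
have nR0 : 0 < n%:R :> R by exact: lt_le_trans nM.
split; first by rewrite -(ltr0n R).
have Dn0 : 0 < D / n%:R by rewrite divr_gt0.
have -> : Num.sqrt (D / n%:R) = expR (2^-1 * ln (D / n%:R)).
  by rewrite -powR12_sqrt ?ltW// /powR gt_eqF.
rewrite -expRM_natl ler_expR lnM ?posrE ?invr_gt0// lnV ?posrE//.
have lln : l <= ln n%:R by rewrite ler_ln ?posrE.
have lD : ln D <= `|ln D| := ler_norm _.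
have E1 : m%:R * M%:R * (ln D - ln n%:R) <= m%:R * M%:R * (`|ln D| - l).
  by rewrite ler_wpM2l ?mulr_ge0//; lra.
have E2 : m%:R * `|ln D| * M%:R <= n%:R * y.
  by apply: le_trans n1; rewrite ler_pM2r.
have E3 : 8 * (n%:R * y) <= m%:R * (M%:R * l).
  apply: (@le_trans _ _ (8 * C1 * (M%:R * l))); last by rewrite ler_pM2r// mulr_gt0.
  by rewrite -!mulrA ler_pM2l// mulrA.
rewrite natrM; lra.
Qed.

End parameters.

Section finite_union.
Context {d : measure_display} {T : measurableType d} {R : realType}.
Variable mu : {measure set T -> \bar R}.

Lemma measure_finite_union (J : choiceType) (s : seq J) (F : J -> set T) :
  (forall j, measurable (F j)) ->
  (mu (\bigcup_(j in [set` s]) F j) <= \sum_(j <- s) mu (F j))%E.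
Proof.
move=> mF; rewrite bigcup_seq; elim: s => [|j s IH].
  by rewrite !big_nil measure0.
rewrite !big_cons; apply: le_trans (measureU2 _ _ _) _ => //.
  by apply: bigsetU_measurable.
by rewrite leeD2l.
Qed.

End finite_union.

(** * The union bound *)

Section interpolation.
Context {R : realType}.

(** Coefficient of the Gaussian entry [e] (matrix, row, column) in row [ir.2] of M_i(tau_i) s_i with
    i = [ir.1]: all coordinates become linear forms in one independent family. *)
Definition interpolation_coef m M n (tau : 'I_m -> R) (s : 'I_m -> 'I_n -> R)
    (ir : 'I_m * 'I_M) (e : 'I_m.+1 * 'I_M * 'I_n) : R :=
  (e.1.2 == ir.2)%:R * ((e.1.1 == ord0)%:R * cos (tau ir.1) +
    (e.1.1 == lift ord0 ir.1)%:R * sin (tau ir.1)) * s ir.1 e.2.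

Lemma sum_triple (A B C : finType) (F : A -> B -> C -> R) :
  \sum_(e : A * B * C) F e.1.1 e.1.2 e.2 = \sum_a \sum_b \sum_c F a b c.
Proof.
rewrite -(pair_bigA _ (fun ab c => F ab.1 ab.2 c)) /=.
by rewrite -(pair_bigA _ (fun a b => \sum_c F a b c)).
Qed.

Lemma sum_pair (A B : finType) (F : A * B -> R) :
  \sum_p F p = \sum_a \sum_b F (a, b).
Proof. by rewrite pair_bigA; apply: eq_bigr => -[]. Qed.

Lemma sum_delta (A : finType) (a : A) (F : A -> R) :
  \sum_x (x == a)%:R * F x = F a.
Proof.
rewrite (bigD1 a)//= eqxx mul1r big1 ?addr0// => x /negbTE ->.
by rewrite mul0r.
Qed.

Lemma interpolate_mulE m M n (A : 'I_m.+1 -> 'M[R]_(M, n)) (tau : 'I_m -> R)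
    (s : 'I_m -> 'I_n -> R) i r :
  (interpolate A i (tau i) *m (\col_b s i b)) r 0 =
  \sum_e interpolation_coef tau s (i, r) e * A e.1.1 e.1.2 e.2.
Proof.
rewrite (sum_triple (fun j r' b =>
  (r' == r)%:R * ((j == ord0)%:R * cos (tau i) +
    (j == lift ord0 i)%:R * sin (tau i)) * s i b * A j r' b)).
rewrite exchange_big /=.
under [RHS]eq_bigr => r' _ do
  (under eq_bigr do (under eq_bigr do rewrite -!mulrA; rewrite -mulr_sumr);
   rewrite -mulr_sumr).
rewrite sum_delta exchange_big mxE /=; apply: eq_bigr => b _.
under eq_bigr do rewrite mulrDl -!mulrA.
rewrite big_split /= !sum_delta !mxE; ring.
Qed.

(** Distinct rows do not interact. In each row M_0 contributes the Gram form at v_i cos(tau_i), and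
    each M_i contributes n (v_i sin(tau_i))^2; both are at least [k] times the squares, and cos^2 +
    sin^2 = 1. *)
Lemma interpolation_coef_coercive m M n (tau : 'I_m -> R) (s : 'I_m -> 'I_n -> R)
    (beta eta : R) (v : 'I_m * 'I_M -> R) :
  (forall i b, s i b ^+ 2 = 1) -> 0 <= beta -> 0 <= eta ->
  (forall i j, i != j ->
    n%:R * (beta - eta) <= \sum_b s i b * s j b <= n%:R * beta) ->
  n%:R * (1 - beta - m%:R * eta) * \sum_ir v ir ^+ 2 <=
  \sum_e (\sum_ir v ir * interpolation_coef tau s ir e) ^+ 2.
Proof.
move=> s2 beta0 eta0 hs.
set k := n%:R * _.
have kn : k <= n%:R.
  rewrite ler_piMr ?ler0n//.
  have : 0 <= m%:R * eta by rewrite mulr_ge0.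
  lra.
pose c j i := (j == ord0)%:R * cos (tau i) + (j == lift ord0 i)%:R * sin (tau i).
have inner e : \sum_ir v ir * interpolation_coef tau s ir e =
    \sum_i v (i, e.1.2) * (c e.1.1 i * s i e.2).
  rewrite sum_pair; apply: eq_bigr => i _; rewrite -(sum_delta e.1.2 (fun r => v (i, r) * _)).
  apply: eq_bigr => r _; rewrite /interpolation_coef /= eq_sym /c; ring.
under [leRHS]eq_bigr do rewrite inner.
rewrite (sum_triple (fun j r b => (\sum_i v (i, r) * (c j i * s i b)) ^+ 2)).
rewrite exchange_big /= sum_pair exchange_big /=.
rewrite mulr_sumr; apply: ler_sum => r _; rewrite big_ord_recl /=.
have -> : \sum_b (\sum_i v (i, r) * (c ord0 i * s i b)) ^+ 2 =
    \sum_b (\sum_i (v (i, r) * cos (tau i)) * s i b) ^+ 2.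
  apply: eq_bigr => b _; congr (_ ^+ 2); apply: eq_bigr => i _.
  by rewrite /c eqxx mul1r mul0r addr0 mulrA.
have -> : \sum_(j < m) \sum_b (\sum_i v (i, r) * (c (lift ord0 j) i * s i b)) ^+ 2 =
    \sum_(i < m) n%:R * (v (i, r) * sin (tau i)) ^+ 2.
  apply: eq_bigr => j _; rewrite mulr_natl -[n in RHS]card_ord -sumr_const.
  apply: eq_bigr => b _.
  have -> : \sum_i v (i, r) * (c (lift ord0 j) i * s i b) =
      \sum_i (i == j)%:R * (v (i, r) * sin (tau i) * s i b).
    apply: eq_bigr => i _; rewrite /c mul0r add0r.
    by rewrite (inj_eq lift_inj) eq_sym; ring.
  by rewrite sum_delta exprMn s2 mulr1.
have gram := gram_lower_bound (fun i => v (i, r) * cos (tau i)) s2 beta0 eta0 hs.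
apply: le_trans (lerD gram (lexx _)).
rewrite -/k !mulr_sumr -big_split /=; apply: ler_sum => i _.
rewrite -[leLHS]mulr1 -[X in _ * X](cos2Dsin2 (tau i)) mulrDr.
rewrite ![(v (i, r) * _) ^+ 2]exprMn -[X in X + _]mulrA lerD2l -mulrA.
by apply: ler_wpM2r kn; rewrite mulr_ge0 ?sqr_ge0.
Qed.

Lemma mx_norm_leP M (A : 'cV[R]_M) (K : R) : 0 <= K ->
  `|A| <= K <-> forall r, `|A r 0| <= K.
Proof.
move=> K0; rewrite [leLHS]mx_normrE; split=> [/bigmax_leP[_ H] r|H].
  exact: (H (r, 0)).
by apply/bigmax_leP; split=> // -[r j] _ /=; rewrite ord1.
Qed.

End interpolation.

(** * Union bound over sign tuples and time tuples *)

Section solutions_probability.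
Context {R : realType} {m M n : nat}.
Context {d : measure_display} {T : measurableType d} {P : probability T R}.
Variables (beta eta K : R) (I : set R) (G : 'I_m.+1 * 'I_M * 'I_n -> {RV P >-> R}).
Hypotheses (I_fin : finite_set I) (K_gt0 : 0 < K) (n_gt0 : (0 < n)%N).

Let J : finType := fset_set I.

Definition overlaps_in (f : {ffun 'I_m -> {ffun 'I_n -> bool}}) : bool :=
  [forall i : 'I_m, forall j : 'I_m, (i < j)%N ==>
    (beta - eta <= n%:R^-1 * overlap (f i) (f j) <= beta)].

Definition candidate_event
    (p : {ffun 'I_m -> {ffun 'I_n -> bool}} * {ffun 'I_m -> J}) : set T :=
  [set w | forall ir, `|\sum_e interpolation_coef (fun i => val (p.2 i))
     (fun i b => spin (p.1 i b)) ir e * G e w| <= K].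

Lemma hypercube_spin (s : 'cV[R]_n) : hypercube s ->
  s = \col_b spin ([ffun b => s b 0 == 1] b).
Proof.
move=> hs; apply/colP => b; rewrite mxE ffunE.
by have [->|->] := hs b; rewrite /spin ?eqxx//; case: eqP => //; lra.
Qed.

Lemma spin_hypercube (f : {ffun 'I_n -> bool}) :
  hypercube (\col_b spin (f b) : 'cV[R]_n).
Proof. by move=> b; rewrite mxE /spin; case: (f b); [right|left]. Qed.

Lemma inner_spin (f g : {ffun 'I_n -> bool}) :
  inner (\col_b spin (f b)) (\col_b spin (g b)) = overlap f g :> R.
Proof. by apply: eq_bigr => b _; rewrite !mxE. Qed.

(** Writes the event as a finite union of measurable events, since both the sign vectors and the
    times range over finite sets. *)
Lemma solutions_nonempty :
  [set w | solutions K beta eta I (matrices_at G w) !=set0] =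
  \bigcup_(p in [set` enum [pred p | overlaps_in p.1]]) candidate_event p.
Proof.
have entry (f : {ffun 'I_m -> {ffun 'I_n -> bool}}) (t : 'I_m -> R) w i r :
    (interpolate (matrices_at G w) i (t i) *m (\col_b spin (f i b))) r 0 =
    \sum_e interpolation_coef t (fun i b => spin (f i b)) (i, r) e * G e w.
  rewrite (interpolate_mulE _ _ (fun i b => spin (f i b))).
  by apply: eq_bigr => -[[j r'] b] _; rewrite !mxE.
apply/seteqP; split => [w [s [hs hov [t [It Hmax]]]]|w [[f t] /=]].
- pose f : {ffun 'I_m -> {ffun 'I_n -> bool}} := [ffun i => [ffun b => s i b 0 == 1]].
  have It' i : t i \in fset_set I by rewrite in_fset_set// inE.
  have sE i : s i = \col_b spin (f i b).
    by rewrite {1}(hypercube_spin (hs i)) /f ffunE.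
  exists (f, [ffun i => [` It' i]%fset]).
    rewrite /= mem_enum inE /=; apply/forallP => i; apply/forallP => j.
    by apply/implyP => ij; have := hov i j ij; rewrite !sE inner_spin.
  move=> [i r] /=.
  have -> : (fun i => val ([ffun i => [` It' i]%fset] i)) = t.
    by apply/funext => j; rewrite ffunE.
  rewrite -entry; move: r; apply/mx_norm_leP; first exact: ltW.
  by rewrite -sE; move/bigmax_leP : Hmax => [_ ->].
- rewrite mem_enum inE /= => ov cand.
  exists (fun i => \col_b spin (f i b)); split.
  + by move=> i; exact: spin_hypercube.
  + move=> i j ij; rewrite inner_spin.
    by move/forallP : ov => /(_ i)/forallP/(_ j)/implyP; exact.
  + exists (fun i => val (t i)); split.
      by move=> i; have := fsvalP (t i); rewrite in_fset_set// inE.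
    apply/bigmax_leP; split; first exact: ltW.
    move=> i _; apply/mx_norm_leP => [|r]; first exact: ltW.
    by rewrite (entry f (fun i => val (t i))); exact: (cand (i, r)).
Qed.

Hypotheses (beta_ge0 : 0 <= beta) (eta_ge0 : 0 <= eta).

Lemma probability_solutions_le (q : R) :
  iid_gaussian_matrices G ->
  0 < q -> q = 1 - beta - m%:R * eta ->
  (P [set w | solutions K beta eta I (matrices_at G w) !=set0] <=
   (#|[pred f | overlaps_in f]|%:R * (#|` fset_set I|)%:R ^+ m *
    Num.sqrt (expR 1 * K ^+ 2 / (n%:R * q)) ^+ (m * M))%:E)%E.
Proof.
move=> [indG normG] q0 qE; rewrite solutions_nonempty.
have mC p : measurable (candidate_event p) by exact: measurable_linear_ball.
apply: (le_trans (measure_finite_union P _ mC)).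
set rho := Num.sqrt _ ^+ _.
have Hp p : overlaps_in p.1 -> (P (candidate_event p) <= rho%:E)%E.
  move=> ov; apply: le_trans (gaussian_small_ball (delta := n%:R * q) _ _ _ _ _) _ => //.
  - by rewrite mulr_gt0// ltr0n.
  - move=> v; rewrite qE; apply: interpolation_coef_coercive => //.
      by move=> i b; exact: spin_sqr.
    have nR : 0 < n%:R :> R by rewrite ltr0n.
    (* The overlap condition is given for i < j only; symmetry extends it to i != j. *)
    have H (i j : 'I_m) : (i < j)%N -> n%:R * (beta - eta) <=
        \sum_b spin (p.1 i b) * spin (p.1 j b) <= n%:R * beta.
      move=> ij; move/forallP : ov => /(_ i)/forallP/(_ j)/implyP/(_ ij).
      by rewrite -/(overlap _ _) ler_pdivlMl// ler_pdivrMl.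
    move=> i j; rewrite -val_eqE neq_ltn => /orP[|ji]; first exact: H.
    by under eq_bigr do rewrite mulrC; exact: H.
  - by rewrite card_prod !card_ord.
apply: (@le_trans _ _ (\sum_(p <- enum
    [pred p : _ * {ffun 'I_m -> J} | overlaps_in p.1]) rho%:E)%E).
  rewrite big_seq [leRHS]big_seq; apply: lee_sum => p.
  by rewrite mem_enum inE => /Hp.
have card_cand : #|[pred p : _ * {ffun 'I_m -> J} | overlaps_in p.1]| =
    (#|[pred f | overlaps_in f]| * #|` fset_set I| ^ m)%N.
  rewrite cardfE -[m in (_ ^ m)%N]card_ord -card_ffun -cardX.
  by apply: eq_card => -[f t]; rewrite !inE andbT.
rewrite sumEFin lee_fin big_const_seq count_predT iter_addr_0 -cardE card_cand.
by rewrite -[leLHS]mulr_natl natrM natrX.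
Qed.

End solutions_probability.

(** * Fixing the constants and adding up the exponents *)

Theorem theorem3p2 (R : realType) (C1 c2 K : R)
    (hc2 : 0 < c2) (hC1 : c2 < C1) (hK : 0 < K) :
  exists (m : nat) (c eta beta : R),
    [/\ (0 < m)%N, 0 < c & [/\ 0 < eta, eta < beta & beta < 1]] /\
    exists c' : R, 0 < c' /\
    exists M0 : nat, forall M n : nat, (M0 <= M)%N ->
      c2 * M%:R * log2 (M%:R) <= n%:R <= C1 * M%:R * log2 (M%:R) ->
    forall I : set R,
      I `<=` `[0, pi / 2] ->
      finite_set I ->
      (#|` fset_set I|)%:R <= 2 `^ (c * n%:R) ->
    forall (d : measure_display) (T : measurableType d) (P : probability T R)
      (G : 'I_m.+1 * 'I_M * 'I_n -> {RV P >-> R}),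
      iid_gaussian_matrices G ->
      (P [set w | solutions K beta eta I (matrices_at G w) !=set0]
        <= (2 `^ (- (c' * n%:R)))%:E)%E.
Proof.
have C10 : 0 < C1 by exact: lt_trans hC1.
pose m := (Num.trunc (8 * C1)).+1.
have Cm : 8 * C1 <= m%:R by rewrite ltW// truncnS_gt.
have m0 : 0 < m%:R :> R by rewrite ltr0n.
have m1 : 1 <= m%:R :> R by rewrite ler1n.
have l20 := @ln2_gt0 R.
(* 2 h m = ln 2, so the [m] overlap factors exp (2 h n) multiply to 2^n. *)
pose h : R := ln 2 / (2 * m%:R).
have h0 : 0 < h by rewrite divr_gt0// mulr_gt0.
have [la [theta [la0 th0 th4 Hla]]] := exists_entropy_parameters h0.
(* m eta = theta / 2 leaves 1 - beta - m eta = theta / 2 > 0, and beta - eta >= 1 - 2 theta. *)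
pose eta := theta / (2 * m%:R); pose beta := 1 - theta.
have eta0 : 0 < eta by rewrite divr_gt0// mulr_gt0.
have meta : m%:R * eta = theta / 2 by rewrite /eta; field; rewrite gt_eqF.
have eta_th : eta <= theta / 2 by rewrite -meta ler_peMl// ltW.
have D0 : 0 < expR 1 * K ^+ 2 / (theta / 2).
  by rewrite divr_gt0 ?mulr_gt0 ?exprn_gt0 ?expR_gt0// divr_gt0.
have [M0 HM0] := small_ball_asymptotics hc2 C10 D0 Cm.
(* c = 1 / m bounds the number of time tuples by 2^n. *)
exists m, m%:R^-1, eta, beta; split.
  split=> //; first by rewrite invr_gt0.
  by split=> //; rewrite /beta; lra.
exists 2^-1; split; first by rewrite invr_gt0.
exists M0 => M n HM Hn I _ I_fin HI d T P G iidG.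
have [n_gt0 small] := HM0 M n HM Hn.
apply: le_trans (probability_solutions_le I_fin hK n_gt0 _ _ iidG (q := theta / 2) _ _) _.
- by rewrite /beta; lra.
- exact: ltW.
- by rewrite divr_gt0.
- by rewrite meta /beta; field.
rewrite lee_fin !pow2E.
have card1 : #|[pred f : {ffun 'I_m -> {ffun 'I_n -> bool}} | overlaps_in beta eta f]|%:R
    <= expR (2 * (n%:R * ln 2)) :> R.
  have nR : 0 < n%:R :> R by rewrite ltr0n.
  apply: (@le_trans _ _ #|[pred f : {ffun 'I_m -> {ffun 'I_n -> bool}} |
      [forall i : 'I_m, forall j : 'I_m, (i < j)%N ==>
        (n%:R * (beta - eta) <= overlap (f i) (f j))]]|%:R).
    rewrite ler_nat; apply: subset_leq_card; apply/fintype.subsetP => f.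
    rewrite !inE => /forallP ov; apply/forallP => i; apply/forallP => j.
    apply/implyP => ij; move: (ov i) => /forallP/(_ j)/implyP/(_ ij)/andP[+ _].
    by rewrite ler_pdivlMl.
  apply: le_trans (card_overlaps_ge la0 _ _) _ => //.
    by rewrite ler_piMr// /beta; lra.
  have -> : expR (2 * (n%:R * ln 2)) = 2 ^+ n * (expR (2 * h) ^+ n) ^+ m :> R.
    have -> : 2 ^+ n = expR (n%:R * ln 2) :> R by rewrite expRM_natl lnK ?posrE.
    have -> : (expR (2 * h) ^+ n) ^+ m = expR (n%:R * ln 2) :> R.
      by rewrite -!expRM_natl /h; congr expR; field; rewrite gt_eqF.
    by rewrite -expRD mulr_natl mulr2n.
  rewrite ler_pM2l ?exprn_gt0// lerXn2r ?nnegrE ?mulr_ge0 ?exprn_ge0 ?addr_ge0 ?expR_ge0//.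
  have -> : expR (- (la * (n%:R * (beta - eta)))) = expR (- (la * (beta - eta))) ^+ n.
    by rewrite -expRM_natl; congr expR; ring.
  rewrite -exprMn lerXn2r ?nnegrE ?mulr_ge0 ?addr_ge0 ?expR_ge0//.
  by apply: Hla; rewrite /beta; lra.
have card2 : (#|` fset_set I|)%:R ^+ m <= expR (n%:R * ln 2) :> R.
  apply: (@le_trans _ _ ((2 `^ (m%:R^-1 * n%:R)) ^+ m)).
    by rewrite lerXn2r ?nnegrE ?powR_ge0.
  rewrite pow2E -expRM_natl ler_expR le_eqVlt; apply/orP; left; apply/eqP.
  by field; rewrite gt_eqF.
have small' : Num.sqrt (expR 1 * K ^+ 2 / (n%:R * (theta / 2))) ^+ (m * M) <=
    expR (- (7 / 2 * n%:R * ln 2)).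
  apply: le_trans small; rewrite le_eqVlt; apply/orP; left; apply/eqP.
  congr (Num.sqrt _ ^+ _); rewrite [n%:R * _]mulrC invfM; ring.
(* In units of n, base 2: 2 + 1 - 7/2 = - 1/2. *)
apply: (@le_trans _ _ (expR (2 * (n%:R * ln 2)) * expR (n%:R * ln 2) *
    expR (- (7 / 2 * n%:R * ln 2)))).
  by rewrite !ler_pM ?mulr_ge0 ?exprn_ge0 ?sqrtr_ge0.
rewrite -!expRD ler_expR le_eqVlt; apply/orP; left; apply/eqP.
by field.
Qed.
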